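(* Let $\mathcal{A}$ be a unital $C^*$-algebra and $a\in \mathcal{A}$. Then the following inequalities hold: $$v^2(a) \geq \frac14 \| a^*a+aa^*\| +\frac12 \Big| \|Re(a)\|^2-\|Im(a)\|^2 \Big| ,$$ $$v^2(a) \geq \frac14 \| a^*a+aa^*\| +\frac14 \Big| \|Re(a) +Im(a)\|^2-\|Re(a)-Im(a)\|^2 \Big| ,$$ $$v^2(a) \geq \frac14 \| a^*a+aa^*\| + \frac14(\alpha+\beta),$$ where $\alpha= \left| \|Re(a)\|^2-\frac14 \| a^*a+aa^*\| \right|$ and $\beta= \left| \|Im(a)\|^2-\frac14 \| a^*a+aa^*\| \right|$.
   Context: $\mathcal{A}$ is a unital $C^*$-algebra with unit $e$. $S(\mathcal{A})$ is the set of normalized states, i.e. continuous linear functionals $f$ on $\mathcal{A}$ with $f(e)=\|f\|=1$. The algebraic numerical radius of $a$ is $v(a)=\sup\{|f(a)|: f\in S(\mathcal{A})\}$, and $v^2(a)$ means $(v(a))^2$. $Re(a)=\frac12(a+a^* )$ and $Im(a)=\frac{1}{2i}(a-a^* )$. *)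

(* Defs.v *)
From HB Require Import structures.
From mathcomp Require Import all_boot all_order all_algebra.
From mathcomp Require Import complex.
From mathcomp Require Import all_classical all_reals all_analysis.

Set Implicit Arguments.
Unset Strict Implicit.
Unset Printing Implicit Defensive.

Import Order.TTheory GRing.Theory Num.Theory.
Import numFieldNormedType.Exports.

Local Open Scope classical_set_scope.
Local Open Scope ring_scope.

(* [CompleteNormedModule] and [GRing.Algebra] cannot be joined: the product
   and the norm of one type already meet in [numDomainType], where the norm
   takes its values in the type itself.  So the algebra structure is given by
   explicit operations, from which the [algType] instance is derived. *)
HB.mixin Record isCstarAlgebra (R : realType) (A : Type)
    of CompleteNormedModule R[i] A := {
  cmul : A -> A -> A;
  cone : A;
  star : A -> A;
  cmulA : associative cmul;
  cmul1x : left_id cone cmul;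
  cmulx1 : right_id cone cmul;
  cmulDl : left_distributive cmul +%R;
  cmulDr : right_distributive cmul +%R;
  cone_neq0 : cone != 0;
  cscaleAl : forall (c : R[i]) (x y : A), c *: cmul x y = cmul (c *: x) y;
  cscaleAr : forall (c : R[i]) (x y : A), c *: cmul x y = cmul x (c *: y);
  starK : involutive star;
  starD : forall x y : A, star (x + y) = star x + star y;
  starZ : forall (c : R[i]) (x : A), star (c *: x) = (c^*)%C *: star x;
  star_cmul : forall x y : A, star (cmul x y) = cmul (star y) (star x);
  norm_cmul_le : forall x y : A, `|cmul x y| <= `|x| * `|y|;
  norm_star_cmul : forall x : A, `|cmul (star x) x| = `|x| ^+ 2
}.

#[short(type="cstarAlgType")]
HB.structure Definition CstarAlgebra (R : realType) :=
  {A of CompleteNormedModule R[i] A & isCstarAlgebra R A}.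

#[non_forgetful_inheritance]
HB.instance Definition _ (R : realType) (A : cstarAlgType R) :=
  GRing.Zmodule_isNzRing.Build (CstarAlgebra.sort A) (@cmulA R A) (@cmul1x R A)
    (@cmulx1 R A) (@cmulDl R A) (@cmulDr R A) (@cone_neq0 R A).
#[non_forgetful_inheritance]
HB.instance Definition _ (R : realType) (A : cstarAlgType R) :=
  GRing.Lmodule_isLalgebra.Build R[i] (CstarAlgebra.sort A) (@cscaleAl R A).
#[non_forgetful_inheritance]
HB.instance Definition _ (R : realType) (A : cstarAlgType R) :=
  GRing.Lalgebra_isAlgebra.Build R[i] (CstarAlgebra.sort A) (@cscaleAr R A).

(* The norm of a normed module over [R[i]] takes its values in [R[i]], where
   it is real and nonnegative; [rnorm] is the same number seen in [R]. *)
Definition rnorm (R : realType) (V : normedModType R[i]) (x : V) : R :=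
  complex.Re `|x|.

Section numerical_radius.
Variables (R : realType) (A : cstarAlgType R).
Implicit Types (a : A) (f : {linear A -> R[i]^o}).

(* [sup] is [0] on unbounded sets, so this is the norm of [f] only when [f]
   is continuous. *)
Definition opnorm f : R := sup [set rnorm (f x) | x in [set x | rnorm x <= 1]].

Definition states : set {linear A -> R[i]^o} :=
  [set f : {linear A -> R[i]^o} | [/\ continuous f, f 1 = 1 & opnorm f = 1]].

Definition numradius a : R := sup [set rnorm (f a) | f in states].

Definition cre a : A := 2^-1 *: (a + star a).
Definition cim a : A := (2 * 'i%C)^-1 *: (a - star a).

End numerical_radius.

(* Main.v *)
(* If [a = x + i y] with [x], [y] self-adjoint, a state [f] is real on [x] and [y],
   so [|f a|^2 = f(x)^2 + f(y)^2], and by Cauchy-Schwarz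
   [|f(c x + s y)|^2 <= (c^2 + s^2) v(a)^2].  Since some state attains
   [|f h| = |h|] on a self-adjoint [h], this gives
   [|c x + s y|^2 <= (c^2 + s^2) v(a)^2]; the three inequalities follow from
   [(c, s)] among [(1, 0)], [(0, 1)], [(1, 1)], [(1, -1)], using
   [a^* a + a a^* = 2 (x^2 + y^2) = (x + y)^2 + (x - y)^2].

   The norming state is obtained without spectral theory.  As
   [|h ^+ k| = |h| ^+ k], bounding the coefficients of [(1 + z h) ^+ n] on a circle
   shows that [|1 + z h|] reaches [1 + |z| |h|] there, whence, for one choice of
   sign, [|1 +- t h| = 1 + t |h|] for all [t >= 0]; Hahn-Banach turns this into a
   state with [f (+- h) = |h|]. *)
From HB Require Import structures.
Require Import Defs.
From mathcomp Require Import all_boot all_order all_algebra.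
From mathcomp Require Import complex.
From mathcomp Require Import all_classical all_reals all_analysis.
From mathcomp Require Import ring lra.
Import Order.TTheory GRing.Theory Num.Theory.
Local Open Scope ring_scope.

(** * Real-valued norms and coefficient bounds for vector polynomials *)

Lemma big_ord_double {V : nmodType} (F : nat -> V) n :
  \sum_(i < n.*2) F i = \sum_(i < n) (F i.*2 + F i.*2.+1).
Proof.
elim: n => [|n IHn]; first by rewrite !big_ord0.
by rewrite doubleS !big_ord_recr /= IHn addrA.
Qed.


Section rnorm.
Set Implicit Arguments.
Unset Strict Implicit.
Context {R : realType} {V : normedModType R[i]}.
Implicit Types x y : V.

Lemma rnormE x : (rnorm x)%:C%C = `|x|.
Proof. exact: RRe_real (normr_real _). Qed.

Lemma rnorm_ge0 x : 0 <= rnorm x.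
Proof. by rewrite -ler0c rnormE normr_ge0. Qed.

Lemma rnorm0 : rnorm (0 : V) = 0.
Proof. by rewrite /rnorm normr0. Qed.

Lemma rnormN x : rnorm (- x) = rnorm x.
Proof. by rewrite /rnorm normrN. Qed.

Lemma ler_rnormD x y : rnorm (x + y) <= rnorm x + rnorm y.
Proof. by rewrite -lecR rmorphD/= !rnormE ler_normD. Qed.

Lemma rnormZ (c : R[i]) x : rnorm (c *: x) = rnorm (c : R[i]^o) * rnorm x.
Proof. by apply: complexI; rewrite rmorphM/= !rnormE normrZ. Qed.

Lemma rnorm_real (t : R) : rnorm (t%:C%C : R[i]^o) = `|t|.
Proof. by rewrite /rnorm normc_def/= expr0n addr0 sqrtr_sqr. Qed.

Lemma rnormZr (t : R) x : rnorm (t%:C%C *: x) = `|t| * rnorm x.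
Proof. by rewrite rnormZ rnorm_real. Qed.

Lemma rnorm_eq0 x : rnorm x = 0 -> x = 0.
Proof. by move=> x0; apply/eqP; rewrite -normr_eq0 -rnormE x0. Qed.

(* Averaging over [z] and [- z] separates the coefficients of even and odd index. *)
Lemma norm_coef_le (n : nat) (c : nat -> V) (B : R) :
  (forall z : R[i], `|z| = 1 -> rnorm (\sum_(i < 2 ^ n) z ^+ i *: c i) <= B) ->
  forall i, (i < 2 ^ n)%N -> rnorm (c i) <= B.
Proof.
elim: n c => [|n IHn] c cB i.
  rewrite expn0 ltnS leqn0 => /eqP ->.
  by have := cB 1 (normr1 _); rewrite expn0 big_ord1 expr0 scale1r.
(* The polynomial at [z] is [E (z ^+ 2) + z *: O (z ^+ 2)], and [E], [O] have half as many terms, so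
   the induction hypothesis applies once both are bounded by [B] on the unit circle. *)
pose E (w : R[i]) := \sum_(i < 2 ^ n) w ^+ i *: c i.*2.
pose O (w : R[i]) := \sum_(i < 2 ^ n) w ^+ i *: c i.*2.+1.
have split_sum z : \sum_(i < 2 ^ n.+1) z ^+ i *: c i = E (z ^+ 2) + z *: O (z ^+ 2).
  rewrite expnS mul2n (big_ord_double (fun i => z ^+ i *: c i)) big_split /=.
  rewrite scaler_sumr; congr (_ + _); apply: eq_bigr => j _.
    by rewrite -exprM mul2n.
  by rewrite scalerA -exprM -exprS mul2n.
have half (x y : V) : rnorm (x + y) <= B -> rnorm (x - y) <= B ->
    rnorm x <= B /\ rnorm y <= B.
  move=> xyB xyB'; have := ler_rnormD (x + y) (x - y); have := ler_rnormD (x + y) (y - x).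
  have -> : x + y + (x - y) = 2%:R%:C%C *: x.
    by rewrite addrACA subrr addr0 rmorph_nat scaler_nat mulr2n.
  have -> : x + y + (y - x) = 2%:R%:C%C *: y.
    by rewrite addrC addrA subrK rmorph_nat scaler_nat mulr2n.
  rewrite -(opprB x y) rnormN !rnormZr ger0_norm//; split; lra.
have EO w : `|w| = 1 -> rnorm (E w) <= B /\ rnorm (O w) <= B.
  move=> w1; pose z := sqrtC w.
  have zw : z ^+ 2 = w by rewrite sqrtCK.
  have z1 : `|z| = 1.
    by apply/eqP; rewrite -(pexpr_eq1 (n:=2))// -normrX zw w1.
  have Oz : rnorm (z *: O w) = rnorm (O w) by rewrite rnormZ /rnorm z1 mul1r.
  rewrite -Oz; apply: half.
    by rewrite -zw -split_sum; exact: cB.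
  rewrite -scaleNr -zw -[in E _](sqrrN z) -[in O _](sqrrN z) -split_sum.
  by apply: cB; rewrite normrN.
rewrite -(odd_double_half i) expnS mul2n.
case: (odd i) => /= i2n.
  rewrite add1n; apply: (IHn (fun i => c i.*2.+1)) => [z /EO[]//|].
  by move: i2n; rewrite add1n -doubleS leq_double.
rewrite add0n; apply: (IHn (fun i => c i.*2)) => [z /EO[]//|].
by move: i2n; rewrite add0n ltn_double.
Qed.

End rnorm.

(** If [x = (1 + e) * y] with [e > 0], Bernoulli gives [(1 + n e)^2 <= (1 + e)^(2 n) <= 2 n + 1],
    where a quadratic growth would stay below a linear one. *)
Lemma ler_of_expr_le_linear {R : realType} (x y : R) : 0 <= y ->
  (forall n, x ^+ n <= n.+1%:R * y ^+ n) -> x <= y.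
Proof.
move=> y0 xy; rewrite leNgt; apply/negP => ltyx.
have x0 : 0 < x by exact: le_lt_trans ltyx.
have {}y0 : 0 < y.
  rewrite lt_def y0 andbT; apply/eqP => y00.
  by have := xy 1%N; rewrite y00 expr1 mulr0 leNgt x0.
pose e := x / y - 1.
have e0 : 0 < e by rewrite subr_gt0 ltr_pdivlMr// mul1r.
have bound n : (1 + e) ^+ n <= n.+1%:R.
  by rewrite /e addrC subrK expr_div_n ler_pdivrMr ?exprn_gt0.
have bern n : 1 + n%:R * e <= (1 + e) ^+ n.
  elim: n => [|n IHn]; first by rewrite mul0r addr0 expr0.
  rewrite exprS; apply: le_trans (ler_wpM2l _ IHn); last lra.
  have : 0 <= n%:R * e * e by rewrite !mulr_ge0// ltW.
  rewrite -natr1; nra.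
(* This makes [n e^2 > 2], so the term [n^2 e^2] alone exceeds [2 n]. *)
pose n := (Num.truncn (2 / e ^+ 2)).+1.
have hn : 2 / e ^+ 2 < n%:R by rewrite truncnS_gt.
have := bound n.*2; rewrite -mul2n exprM exprAC => h2.
have := bern n => h1.
have h3 : (1 + n%:R * e) ^+ 2 <= (1 + e) ^+ n ^+ 2.
  by rewrite ler_sqr ?nnegrE// ?exprn_ge0//; have := ler0n R n; nra.
have {}hn : 2 < n%:R * e ^+ 2 by rewrite -ltr_pdivrMr ?exprn_gt0.
have n0 : 0 < n%:R :> R by rewrite ltr0n.
have := le_trans h3 h2; rewrite -natr1 natrM => h4.
have : n%:R * 2 < n%:R * (n%:R * e ^+ 2) by rewrite ltr_pM2l.
nra.
Qed.

(** * Sublinear functionals and the real Hahn-Banach theorem *)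

Section hahn_banach.
Set Implicit Arguments.
Unset Strict Implicit.
Context {R : realType} {V : lmodType R[i]}.
Implicit Types (p q : V -> R) (x y : V) (t : R).

(** Scalars are real here, since the functional to be found is the real part of a state. *)
Definition sublinear p :=
  (forall x y, p (x + y) <= p x + p y) /\
  (forall t x, 0 <= t -> p (t%:C%C *: x) = t * p x).

Lemma sublinear0 p : sublinear p -> p 0 = 0.
Proof.
move=> [_ pZ].
by rewrite -(scale0r (0 : V)) -(rmorph0 (real_complex R)) pZ// mul0r.
Qed.

Lemma sublinearN p x : sublinear p -> - p (- x) <= p x.
Proof. by move=> ps; have := ps.1 x (- x); rewrite subrr sublinear0//; lra. Qed.

Lemma sublinear_of_le p : (forall x y, p (x + y) <= p x + p y) -> p 0 = 0 ->
  (forall t x, 0 < t -> p (t%:C%C *: x) <= t * p x) -> sublinear p.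
Proof.
move=> pD p0 pZ; split=> // t x; rewrite le_eqVlt => /predU1P[<-|t0].
  by rewrite rmorph0 scale0r p0 mul0r.
apply/eqP; rewrite eq_le pZ//=.
have tV : 0 < t^-1 by rewrite invr_gt0.
have := pZ _ (t%:C%C *: x) tV.
by rewrite scalerA -rmorphM/= mulVf ?gt_eqF// scale1r ler_pdivlMl.
Qed.

(** Take for [q y] the infimum of [p (y + t x) - t m] over [t >= 0]. As [t m <= p (t x)], it is
    bounded below by [- p (- y)]; the value [t = 1] gives [q (- x) <= - m]. The last clause keeps
    the infimum property, for lower bounds on [q]. *)
Lemma sublinear_lower p x m : sublinear p -> m <= p x ->
  exists q, [/\ sublinear q, forall y, q y <= p y, q (- x) <= - m &
    forall y c, (forall t, 0 <= t -> c <= p (y + t%:C%C *: x) - t * m) -> c <= q y].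
Proof.
move=> ps mp; have [pD pZ] := ps.
pose S y := [set p (y + t%:C%C *: x) - t * m | t in [set t | 0 <= t]]%classic.
have S0 y : (S y !=set0)%classic by exists (p (y + 0%:C%C *: x) - 0 * m), 0 => /=.
have Slb y : lbound (S y) (- p (- y)).
  move=> _ [t /= t0 <-]; have := pD (- y) (y + t%:C%C *: x).
  by rewrite addKr pZ//; have := ler_wpM2l t0 mp; lra.
have Sle y t : 0 <= t -> inf (S y) <= p (y + t%:C%C *: x) - t * m.
  by move=> t0; apply: ge_inf; [exists (- p (- y)) | exists t].
have Sge y c : (forall t, 0 <= t -> c <= p (y + t%:C%C *: x) - t * m) -> c <= inf (S y).
  by move=> cS; apply: lb_le_inf => // _ [t /= t0 <-]; exact: cS.
have Sp y : inf (S y) <= p y.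
  by have := Sle y 0 (lexx _); rewrite rmorph0 scale0r addr0 mul0r subr0.
exists (fun y => inf (S y)); split => //.
- apply: sublinear_of_le => [y z||t y t0].
  + rewrite -lerBlDr; apply: (Sge) => t t0.
    rewrite lerBlDr -lerBlDl; apply: (Sge) => s s0.
    have := Sle (y + z) (t + s) (addr_ge0 t0 s0).
    have := pD (y + t%:C%C *: x) (z + s%:C%C *: x).
    by rewrite addrACA -scalerDl -rmorphD/=; lra.
  + apply/eqP; rewrite eq_le -[leRHS](sublinear0 ps) Sp/=.
    by have := lb_le_inf (S0 0) (Slb 0); rewrite oppr0 sublinear0// oppr0.
  + rewrite mulrC -ler_pdivrMr//; apply: (Sge) => s s0.
    rewrite ler_pdivrMr//; have := Sle (t%:C%C *: y) (t * s).
    rewrite rmorphM/= -scalerA -scalerDr (pZ _ _ (ltW t0)) mulr_ge0 ?(ltW t0)// => /(_ isT).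
    by lra.
- by have := Sle (- x) 1 ler01; rewrite rmorph1 scale1r addNr sublinear0//; lra.
Qed.

(** Zorn's lemma for the reversed pointwise order. A nonempty chain is bounded by its pointwise
    infimum, finite because [r x >= - r (- x) >= - p (- x)]. *)
Lemma minimal_sublinear p : sublinear p ->
  exists q, [/\ sublinear q, forall x, q x <= p x &
    forall r, sublinear r -> (forall x, r x <= q x) -> r = q].
Proof.
move=> ps; pose T := {q : V -> R | sublinear q /\ forall x, q x <= p x}.
pose below (q r : T) : bool := `[< forall x, sval r x <= sval q x >].
have [|||F Ftot|[q [qs qp]] qmin] := @Zorn T below.
- by move=> q; apply/asboolP.
- move=> q r s /asboolP qr /asboolP rs; apply/asboolP => x.
  exact: le_trans (rs x) (qr x).
- move=> [q hq] [r hr] /asboolP/= qr /asboolP/= rq; apply: eq_exist.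
  by apply/funext => x; apply/eqP; rewrite eq_le qr rq.
- have [F0|/set0P[r0 Fr0]] := eqVneq F set0.
    exists (exist _ p (conj ps (fun x => lexx _))) => r; rewrite F0//.
  pose S x := [set sval r x | r in F]%classic.
  have S0 x : (S x !=set0)%classic by exists (sval r0 x), r0.
  have Slb x : lbound (S x) (- p (- x)).
    move=> _ [[r [rs rp]] _ <-] /=; have := rp (- x); have := sublinearN x rs; lra.
  have Sle x r : F r -> inf (S x) <= sval r x.
    by move=> Fr; apply: ge_inf; [exists (- p (- x)) | exists r].
  have Sge x c : (forall r, F r -> c <= sval r x) -> c <= inf (S x).
    by move=> cS; apply: lb_le_inf => // _ [r /= Fr <-]; exact: cS.
  have ms : sublinear (fun x => inf (S x)).
    apply: sublinear_of_le => [x y||t x t0].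
    + rewrite -lerBlDr; apply: (Sge) => r Fr.
      rewrite lerBlDr -lerBlDl; apply: (Sge) => s Fs; rewrite lerBlDl.
      (* In a chain, the smaller of [r] and [s] serves at both [x] and [y]. *)
      have [/asboolP sr|/asboolP rs] := Ftot _ _ Fr Fs.
        apply: le_trans (Sle _ _ Fs) _; apply: le_trans ((svalP s).1.1 _ _) _.
        by rewrite lerD2r.
      apply: le_trans (Sle _ _ Fr) _; apply: le_trans ((svalP r).1.1 _ _) _.
      by rewrite lerD2l.
    + apply/eqP; rewrite eq_le -[leRHS](sublinear0 (svalP r0).1) Sle//=.
      by apply: (Sge) => r _; rewrite (sublinear0 (svalP r).1).
    + rewrite mulrC -ler_pdivrMr//; apply: (Sge) => r Fr.
      rewrite ler_pdivrMr//; apply: le_trans (Sle _ _ Fr) _.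
      by rewrite (svalP r).1.2 ?(ltW t0)// mulrC.
  have mp x : inf (S x) <= p x := le_trans (Sle x _ Fr0) ((svalP r0).2 x).
  have mT : sublinear (fun x => inf (S x)) /\ forall x, inf (S x) <= p x by [].
  by exists (exist _ _ mT : T) => r Fr; apply/asboolP => x /=; exact: Sle.
exists q; split=> // r rs rq.
have rp x : r x <= p x := le_trans (rq x) (qp x).
have rT : sublinear r /\ forall x, r x <= p x by [].
by have := qmin (exist _ r rT : T) (asboolT rq) => /(congr1 sval).
Qed.

(* A minimal sublinear functional is linear, since otherwise
   [sublinear_lower] would decrease it. *)
Lemma hahn_banach_sublinear p : sublinear p ->
  exists g : V -> R, [/\ forall x, g x <= p x,
    forall x y, g (x + y) = g x + g y & forall t x, g (t%:C%C *: x) = t * g x].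
Proof.
move=> /minimal_sublinear[q [qs qp qmin]]; exists q.
have qN x : q (- x) = - q x.
  apply/eqP; rewrite eq_le lerNl sublinearN// andbT.
  (* Lowering with [m = q x] gives [r (- x) <= - q x], and [r = q] by minimality. *)
  have [r [rs rq rx _]] := sublinear_lower qs (lexx (q x)).
  by rewrite -(qmin r rs rq) in rx *.
split=> // [x y|t x].
  apply/eqP; rewrite eq_le qs.1/=.
  by have := qs.1 (- x) (- y); rewrite -opprD !qN; lra.
have [t0|t0] := leP 0 t; first exact: qs.2.
by rewrite -[LHS]opprK -qN -scaleNr -rmorphN/= qs.2 ?mulNr ?opprK// oppr_ge0 ltW.
Qed.

End hahn_banach.

(** * Norms of self-adjoint elements and of their perturbations of the unit *)

Section cstar.
Set Implicit Arguments.
Unset Strict Implicit.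
Context {R : realType} {A : cstarAlgType R}.
Implicit Types (x y h a : A) (t : R) (z : R[i]).

Lemma rnormM x y : rnorm (x * y) <= rnorm x * rnorm y.
Proof. by rewrite -lecR rmorphM/= !rnormE norm_cmul_le. Qed.

Lemma rnorm_starM x : rnorm (star x * x) = rnorm x ^+ 2.
Proof. by apply: complexI; rewrite rmorphXn/= !rnormE; exact: norm_star_cmul. Qed.

Lemma star1 : star (1 : A) = 1.
Proof.
have e x : star 1 * x = x.
  by rewrite -{1}[x]starK -[LHS]star_cmul; rewrite [cmul _ _]mulr1 starK.
by rewrite -[LHS]mulr1 e.
Qed.

Lemma rnorm1 : rnorm (1 : A) = 1.
Proof.
have := rnorm_starM 1; rewrite star1 mulr1 expr2 => /esym n1.
have [/rnorm_eq0/eqP|n0] := eqVneq (rnorm (1 : A)) 0; first by rewrite oner_eq0.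
by apply: (mulfI n0); rewrite mulr1.
Qed.

Lemma starN x : star (- x) = - star x.
Proof. by rewrite -scaleN1r starZ rmorphN1 scaleN1r. Qed.

Lemma star_real t x : star (t%:C%C *: x) = t%:C%C *: star x.
Proof. by rewrite starZ conjc_real. Qed.

Lemma rnormX x n : rnorm (x ^+ n) <= rnorm x ^+ n.
Proof.
elim: n => [|n IHn]; first by rewrite !expr0 rnorm1.
by rewrite !exprS (le_trans (rnormM _ _))// ler_wpM2l// rnorm_ge0.
Qed.

Lemma starX x n : star (x ^+ n) = star x ^+ n.
Proof.
elim: n => [|n IHn]; first by rewrite !expr0 star1.
by rewrite exprS [star _]star_cmul IHn exprSr.
Qed.

(** The C*-identity gives the exponents [2 ^ j] by repeated squaring. For any [n], split
    [h ^+ (2 ^ n)] as [h ^+ n * h ^+ (2 ^ n - n)] and cancel the power of [rnorm h]. *)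
Lemma rnorm_selfadjX h n : star h = h -> rnorm (h ^+ n) = rnorm h ^+ n.
Proof.
move=> hh; have dyadic j : rnorm (h ^+ (2 ^ j)) = rnorm h ^+ (2 ^ j).
  elim: j => [|j IHj]; first by rewrite expn0 !expr1.
  rewrite expnSr !exprM -IHj -rnorm_starM starX hh expr2//.
have [h0|h0] := eqVneq (rnorm h) 0.
  rewrite (rnorm_eq0 h0); case: n => [|n]; first by rewrite !expr0 rnorm1.
  by rewrite expr0n/= rnorm0 expr0n.
apply/eqP; rewrite eq_le rnormX/=.
have n2 : (n <= 2 ^ n)%N by rewrite ltnW// ltn_expl.
have hn : 0 < rnorm h ^+ (2 ^ n - n).
  by rewrite exprn_gt0// lt_def h0 rnorm_ge0.
rewrite -(ler_pM2r hn) -exprD subnKC// -dyadic -{1}(subnKC n2) exprD.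
by apply: le_trans (rnormM _ _) _; rewrite ler_wpM2l ?rnorm_ge0 ?rnormX.
Qed.

(* Summing the coefficients of [(1 + z h) ^+ n], each bounded by [M ^+ n],
   gives [(1 + d |h|) ^+ n <= n.+1 * M ^+ n]. *)
Lemma rnorm_radial h (d M : R) : 0 <= d ->
  (forall n, rnorm (h ^+ n) = rnorm h ^+ n) ->
  (forall z, `|z| = 1 -> rnorm (1 + (z * d%:C%C) *: h) <= M) ->
  1 + d * rnorm h <= M.
Proof.
move=> d0 hX hM.
have M0 : 0 <= M by apply: le_trans (hM 1 (normr1 _)); exact: rnorm_ge0.
apply: ler_of_expr_le_linear => // n.
pose c i : A := (d ^+ i *+ 'C(n, i))%:C%C *: h ^+ i.
have c_le i : (i <= n)%N -> rnorm (c i) <= M ^+ n.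
  (* The binomial expansion is padded to [2 ^ n.+1] terms, the shape required by [norm_coef_le]; the
     added binomial coefficients vanish. *)
  move=> i_n; apply: (norm_coef_le (n := n.+1)); last first.
    by apply: leq_ltn_trans i_n _; rewrite (ltn_trans (ltnSn _))// ltn_expl.
  move=> z z1; suff -> : \sum_(i < 2 ^ n.+1) z ^+ i *: c i
      = (1 + (z * d%:C%C) *: h) ^+ n.
    apply: le_trans (rnormX _ _) _; rewrite lerXn2r ?nnegrE ?rnorm_ge0//.
    exact: hM.
  rewrite exprDn_comm; last exact: commr_sym (commr1 _).
  have n2 : (n.+1 <= 2 ^ n.+1)%N by rewrite ltnW// ltn_expl.
  rewrite [RHS](big_ord_widen _
    (fun i => 1 ^+ (n - i) * ((z * d%:C%C) *: h) ^+ i *+ 'C(n, i)) n2).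
  rewrite [RHS]big_mkcond /=; apply: eq_bigr => j _.
  rewrite /c exprZn expr1n mul1r scalerA; case: ltnP => [_|nj].
    by rewrite rmorphMn/= rmorphXn/= mulrnAr exprMn [RHS]scalerMnl.
  by rewrite bin_small// mulr0n rmorph0 mulr0 scale0r.
rewrite exprDn mulr_natl -[X in _ *+ X]card_ord -sumr_const.
apply: ler_sum => i _; rewrite expr1n mul1r.
apply: le_trans (c_le i _); last by rewrite -ltnS.
rewrite /c rnormZr hX ger0_norm ?mulrn_wge0 ?exprn_ge0//.
by rewrite exprMn mulrnAl.
Qed.

(** The C*-identity applied to [1 + z h], whose product with its adjoint is
    [1 + 2 Re(z) h + |z|^2 h^2]: a complex perturbation is controlled by a real one. *)
Lemma rnorm_1Dscale_sq h z : star h = h ->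
  rnorm (1 + z *: h) ^+ 2 <=
  rnorm (1 + (2 * complex.Re z)%:C%C *: h) + (rnorm (z : R[i]^o) * rnorm h) ^+ 2.
Proof.
move=> hh; rewrite -rnorm_starM starD star1 starZ hh.
have -> : (1 + z^*%C *: h) * (1 + z *: h) =
    1 + (2 * complex.Re z)%:C%C *: h + (z^*%C * z) *: (h ^+ 2).
  rewrite mulrDl mul1r mulrDr mulr1 -scalerAl -scalerAr scalerA -expr2 -!addrA.
  by rewrite [in RHS]rmorphM/= rmorph_nat -addcJ scalerDl -!addrA.
apply: le_trans (ler_rnormD _ _) _; rewrite lerD2l rnormZ rnorm_selfadjX//.
rewrite exprMn; have -> : rnorm (z^*%C * z : R[i]^o) = rnorm (z : R[i]^o) ^+ 2.
  by rewrite [LHS](rnormZ _ (z : R[i]^o)) expr2 /rnorm normcJ.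
by [].
Qed.

(* [rnorm_radial] on the circle of radius [t / 2], through [rnorm_1Dscale_sq]. *)
Lemma rnorm_selfadj_max h t : star h = h -> 0 <= t ->
  1 + t * rnorm h <= Num.max (rnorm (1 + t%:C%C *: h)) (rnorm (1 - t%:C%C *: h)).
Proof.
move=> hh; rewrite le_eqVlt => /predU1P[<-|t0].
  by rewrite mul0r addr0 rmorph0 scale0r addr0 rnorm1 le_max lexx.
set M := Num.max _ _.
have hp : rnorm (1 + t%:C%C *: h) <= M by rewrite le_max lexx.
have hm : rnorm (1 - t%:C%C *: h) <= M by rewrite le_max lexx orbT.
(* On the segment, [1 + s h] is a convex combination of the endpoints [1 + t h] and [1 - t h]. *)
have segment (s : R) : - t <= s -> s <= t -> rnorm (1 + s%:C%C *: h) <= M.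
  move=> ts st; pose u := (t + s) / (2 * t); pose v := (t - s) / (2 * t).
  have u0 : 0 <= u by rewrite divr_ge0//; lra.
  have v0 : 0 <= v by rewrite divr_ge0//; lra.
  have uv : u + v = 1 by rewrite /u /v; field; rewrite gt_eqF.
  have uvs : u * t + v * - t = s by rewrite /u /v; field; rewrite gt_eqF.
  have -> : 1 + s%:C%C *: h =
      u%:C%C *: (1 + t%:C%C *: h) + v%:C%C *: (1 - t%:C%C *: h).
    rewrite -[1 in LHS](scale1r (1 : A)) -[1 in LHS](rmorph1 (real_complex R)).
    rewrite -uv -uvs !rmorphD !rmorphM rmorphN/= !scalerDl -scaleNr !scalerDr.
    by rewrite !scalerA addrACA.
  apply: le_trans (ler_rnormD _ _) _; rewrite !rnormZr !ger0_norm//.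
  by rewrite -[M]mul1r -uv mulrDl; apply: lerD; exact: ler_wpM2l.
have n0 := rnorm_ge0 h.
have M0 : 0 <= M by apply: le_trans hp; exact: rnorm_ge0.
(* For [|z| = d], the number [2 Re(z)] stays in [[- t, t]]. Squaring the resulting bound cancels
   [(d |h|)^2] and leaves [1 + 2 d |h| <= M]. *)
pose d := t / 2.
have : 1 + d * rnorm h <= Num.sqrt (M + (d * rnorm h) ^+ 2).
  apply: rnorm_radial => [|n|z z1]; first by rewrite /d; lra.
    exact: rnorm_selfadjX.
  have zd : rnorm (z * d%:C%C : R[i]^o) = d.
    rewrite [LHS](rnormZ z (d%:C%C : R[i]^o)) rnorm_real ger0_norm; last first.
      by rewrite divr_ge0 ?ltW.
    by rewrite /rnorm z1 mul1r.
  rewrite -[leLHS]ger0_norm ?rnorm_ge0// -sqrtr_sqr ler_wsqrtr//.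
  apply: le_trans (rnorm_1Dscale_sq _ hh) _; rewrite zd lerD2r.
  have : `|complex.Re z| <= 1 by rewrite -lecR (le_trans (normc_ge_Re _))// z1.
  rewrite ler_norml => /andP[z1' z1''].
  have -> : complex.Re (z * d%:C%C) = complex.Re z * d.
    by case: (z) => x y /=; rewrite mulr0 subr0.
  by apply: segment; rewrite /d; nra.
rewrite -(@ler_sqr _ (1 + _)) ?nnegrE ?sqrtr_ge0//; last by rewrite /d; nra.
rewrite sqr_sqrtr; last by rewrite addr_ge0// sqr_ge0.
by rewrite /d; lra.
Qed.

(** By convexity, a strict inequality at [t] for one sign persists at every [s] with [0 < s <= t].
    Failures at [t1] for [h] and at [t2] for [- h] would thus both occur at [Num.min t1 t2], against
    [rnorm_selfadj_max]. *)
Lemma rnorm_selfadj_sign h : star h = h ->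
  (forall t, 0 <= t -> 1 + t * rnorm h <= rnorm (1 + t%:C%C *: h)) \/
  (forall t, 0 <= t -> 1 + t * rnorm h <= rnorm (1 - t%:C%C *: h)).
Proof.
move=> hh; set n := rnorm h.
have mono x s t : 0 < s <= t -> rnorm (1 + t%:C%C *: x) < 1 + t * n ->
    rnorm (1 + s%:C%C *: x) < 1 + s * n.
  move=> /andP[s0 st] xt; have t0 : 0 < t by exact: lt_le_trans st.
  pose r := s / t; have r0 : 0 < r by rewrite divr_gt0.
  have r1 : r <= 1 by rewrite ler_pdivrMr// mul1r.
  have sE : s = r * t by rewrite /r divfK// gt_eqF.
  have -> : 1 + s%:C%C *: x = (1 - r)%:C%C *: 1 + r%:C%C *: (1 + t%:C%C *: x).
    rewrite scalerDr scalerA addrA -scalerDl -rmorphD/= subrK scale1r.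
    by rewrite -rmorphM/= -sE.
  apply: le_lt_trans (ler_rnormD _ _) _; rewrite !rnormZr rnorm1 mulr1.
  rewrite !ger0_norm ?subr_ge0 ?(ltW r0)// sE -mulrA.
  by have := xt; rewrite -(ltr_pM2l r0); lra.
apply: contrapT => /not_orP[/existsNP[t1 /not_implyP[t10 /negP]]].
rewrite -ltNge => h1 /existsNP[t2 /not_implyP[t20 /negP]].
rewrite -ltNge => h2.
have pos x t : 0 <= t -> rnorm (1 + t%:C%C *: x) < 1 + t * n -> 0 < t.
  rewrite le_eqVlt => /predU1P[<-|//].
  by rewrite mul0r addr0 rmorph0 scale0r addr0 rnorm1 ltxx.
rewrite -scalerN in h2.
have := rnorm_selfadj_max hh (t := Num.min t1 t2); rewrite le_min t10 t20 => /(_ isT).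
have t0 : 0 < Num.min t1 t2 by rewrite lt_min (pos _ _ _ h1)// (pos _ _ _ h2).
rewrite leNgt gt_max (mono _ _ _ _ h1)/= -?scalerN ?(mono _ _ _ _ h2)//.
  by rewrite t0 ge_min lexx orbT.
by rewrite t0 ge_min lexx.
Qed.

End cstar.

(** * States: contractivity, reality on self-adjoint elements, existence *)

Section states.
Set Implicit Arguments.
Unset Strict Implicit.
Context {R : realType} {A : cstarAlgType R}.
Implicit Types (x y h a : A) (f : {linear A -> R[i]^o}) (t : R).

Lemma rnorm_complex_sqr (z : R[i]) :
  rnorm (z : R[i]^o) ^+ 2 = complex.Re z ^+ 2 + complex.Im z ^+ 2.
Proof. by rewrite /rnorm normc_def/= sqr_sqrtr// addr_ge0 ?sqr_ge0. Qed.

Lemma state_le_rnorm f x : states f -> rnorm (f x) <= rnorm x.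
Proof.
move=> [_ _ f1]; pose S := [set rnorm (f x) | x in [set x | rnorm x <= 1]]%classic.
(* Without a supremum, [sup S] would take the default value [0] instead of [1]. *)
have supS : has_sup S.
  by apply: contrapT => /sup_out; rewrite [sup S]f1 => /eqP; rewrite oner_eq0.
have [/rnorm_eq0 ->|x0] := eqVneq (rnorm x) 0; first by rewrite linear0 !rnorm0.
have {}x0 : 0 < rnorm x by rewrite lt_def x0 rnorm_ge0.
have xV : 0 <= (rnorm x)^-1 by rewrite invr_ge0 ltW.
have : S (rnorm (f ((rnorm x)^-1%:C%C *: x))).
  by exists ((rnorm x)^-1%:C%C *: x) => //=; rewrite rnormZr ger0_norm// mulVf ?gt_eqF.
move=> /(ub_le_sup supS.2); rewrite [sup S]f1 linearZ/= rnormZr ger0_norm//.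
by rewrite mulrC ler_pdivrMr// mul1r.
Qed.

Lemma state_of_bounded f : (forall x, rnorm (f x) <= rnorm x) -> f 1 = 1 -> states f.
Proof.
move=> fb f1; split=> //.
  apply/linear_bounded_continuous/bounded_funP => r; exists r => x xr.
  by apply: le_trans xr; rewrite -!rnormE lecR.
have n1 : rnorm (f 1) = 1 by rewrite f1 /rnorm normr1.
apply/eqP; rewrite eq_le; apply/andP; split.
  apply: ge_sup; first by exists 1, 1 => //=; rewrite rnorm1.
  by move=> _ [x /= x1 <-]; exact: le_trans (fb x) x1.
apply: ub_le_sup; last by exists 1 => //=; rewrite rnorm1.
by exists 1 => _ [x /= x1 <-]; exact: le_trans (fb x) x1.
Qed.

(** With [f h = u + i v], the bound [|f (h + i t)|^2 <= |h + i t|^2 <= |h|^2 + t^2] reads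
    [u^2 + v^2 + 2 v t <= |h|^2] for all real [t], which forces [v = 0]. *)
Lemma state_selfadj_real f h : states f -> star h = h -> complex.Im (f h) = 0.
Proof.
move=> fs hh; have [_ f1 _] := fs; set u := complex.Re (f h); set v := complex.Im (f h).
have bound t : u ^+ 2 + (v + t) ^+ 2 <= rnorm h ^+ 2 + t ^+ 2.
  have fE : f (h + ('i%C * t%:C%C) *: 1) = f h + 'i%C * t%:C%C.
    by rewrite linearD linearZ/= f1 [_ *: _]mulr1.
  have := state_le_rnorm (h + ('i%C * t%:C%C) *: 1) fs.
  rewrite -(@ler_sqr _ (rnorm (f _))) ?nnegrE ?rnorm_ge0// fE rnorm_complex_sqr.
  rewrite -(rnorm_starM (h + _)) starD starZ star1 hh.
  have -> : complex.Re (f h + 'i%C * t%:C%C) = u.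
    by rewrite /u; case: (f h) => c d /=; ring.
  have -> : complex.Im (f h + 'i%C * t%:C%C) = v + t.
    by rewrite /v; case: (f h) => c d /=; ring.
  have -> : (('i%C * t%:C%C)^*)%C = - ('i%C * t%:C%C) :> R[i].
    by apply/eqP; rewrite eq_complex/=; apply/andP; split; apply/eqP; ring.
  have ww : ('i%C * t%:C%C) * ('i%C * t%:C%C) = - (t ^+ 2)%:C%C :> R[i].
    by rewrite mulrACA -expr2 sqr_i mulN1r -rmorphM.
  have -> : (h + (- ('i%C * t%:C%C)) *: 1) * (h + ('i%C * t%:C%C) *: 1) =
      h * h + (t ^+ 2)%:C%C *: (1 : A).
    rewrite scaleNr mulrDl !mulrDr !mulNr mulr_algr !mulr_algl scalerA ww.
    by rewrite addrA addrK scaleNr opprK.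
  move=> /le_trans; apply; apply: le_trans (ler_rnormD _ _) _.
  by rewrite rnormZr rnorm1 mulr1 -expr2 rnorm_selfadjX// ger0_norm ?sqr_ge0.
apply/eqP/negPn/negP => v0.
(* This [t] makes [2 v t = |h|^2], leaving [u^2 + v^2 <= 0]. *)
have := bound (rnorm h ^+ 2 / (2 * v)).
have -> : (v + rnorm h ^+ 2 / (2 * v)) ^+ 2 =
  v ^+ 2 + rnorm h ^+ 2 + (rnorm h ^+ 2 / (2 * v)) ^+ 2 by field; exact: v0.
have : 0 < v ^+ 2 by rewrite exprn_even_gt0.
by have := sqr_ge0 u; lra.
Qed.

Lemma exists_state x (n : R) :
  (forall t, 0 <= t -> 1 + t * n <= rnorm (1 + t%:C%C *: x)) ->
  exists2 f, states f & n <= complex.Re (f x).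
Proof.
move=> xn.
have rs : sublinear (@rnorm R A).
  by split=> [y z|t y t0]; rewrite ?ler_rnormD// rnormZr ger0_norm.
have n1 : 1 <= rnorm (1 : A) by rewrite rnorm1.
(* Lowering the norm at [- 1] and then at [- x] forces [g 1 = 1] and [n <= g x]
   for every linear [g] below the result. *)
have [p [ps pr p1 p_ge]] := @sublinear_lower _ _ _ (1 : A) 1 rs n1.
(* The required [t + n <= |x + t|] is the hypothesis at [t^-1] multiplied by [t]; for [t = 0] it
   follows from the hypothesis at [1] and the triangle inequality. *)
have px : n <= p x.
  apply: p_ge => t; rewrite le_eqVlt => /predU1P[<-|t0].
    rewrite rmorph0 scale0r addr0 mul0r subr0.
    have := le_trans (xn 1 ler01) (ler_rnormD _ _).
    by rewrite rnorm1 rmorph1 scale1r mul1r lerD2l.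
  have := xn t^-1; rewrite invr_ge0 ltW// => /(_ isT).
  rewrite -(ler_pM2l t0) -{3}(ger0_norm (ltW t0)) -rnormZr scalerDr scalerA.
  rewrite -rmorphM/= mulfV ?gt_eqF// scale1r mulrDr mulrA mulfV ?gt_eqF// addrC.
  by rewrite [x + _]addrC; lra.
have [q [qs qp qx _]] := sublinear_lower ps px.
have [g [gq gD gZ]] := hahn_banach_sublinear qs.
have gN y : g (- y) = - g y.
  by rewrite -scaleN1r -(rmorphN1 (real_complex R)) gZ mulN1r.
have gr y : g y <= rnorm y := le_trans (gq y) (le_trans (qp y) (pr y)).
have gx : n <= g x by have := le_trans (gq (- x)) qx; rewrite gN lerN2.
have g1 : g 1 = 1.
  apply/eqP; rewrite eq_le; have := gr 1; rewrite rnorm1 => -> /=.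
  by have := le_trans (gq _) (le_trans (qp _) p1); rewrite gN lerN2.
(* The complex-linear functional with real part [g]. *)
pose F (y : A) : R[i]^o := (g y +i* - g ('i%C *: y))%C.
have gC (c d : R) y : g ((c +i* d)%C *: y) = c * g y + d * g ('i%C *: y).
  have -> : (c +i* d)%C = c%:C%C + d%:C%C * 'i%C :> R[i].
    by apply/eqP; rewrite eq_complex/=; apply/andP; split; apply/eqP; ring.
  by rewrite scalerDl -scalerA gD !gZ.
have Flin : linear F.
  move=> [c d] y z; apply/eqP; rewrite eq_complex/= scalerDr scalerA !gD.
  have -> : 'i%C * (c +i* d)%C = (- d +i* c)%C :> R[i].
    by apply/eqP; rewrite eq_complex/=; apply/andP; split; apply/eqP; ring.
  by rewrite (gC c d) (gC (- d) c); apply/andP; split; apply/eqP; ring.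
pose f : {linear A -> R[i]^o} := HB.pack F (GRing.isLinear.Build _ _ _ _ F Flin).
have fr y : rnorm (f y) <= rnorm y.
  have [->|fy0] := eqVneq (f y) 0; first by rewrite rnorm0 rnorm_ge0.
  (* This phase makes [f (c y)] real, so [|f y| = g (c y) <= |c y| = |y|]. *)
  pose c : R[i] := `|f y| / f y.
  have c1 : `|c| = 1 by rewrite normrM normfV normr_id mulfV// normr_eq0.
  have : f (c *: y) = (rnorm (f y))%:C%C.
    by rewrite linearZ/= rnormE [LHS]mulfVK.
  move=> /(congr1 (@complex.Re R)) /= <-; apply: le_trans (gr _) _.
  by rewrite rnormZ /rnorm c1 mul1r.
exists f => //; apply: state_of_bounded => //.
(* Since [f 1] has real part [1] and modulus at most [1], its imaginary part vanishes. *)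
apply/eqP; rewrite eq_complex /= g1 eqxx/=.
have := fr 1; rewrite -(@ler_sqr _ (rnorm (f _))) ?nnegrE ?rnorm_ge0//.
rewrite rnorm_complex_sqr rnorm1/= g1 sqrrN; have := sqr_ge0 (g ('i%C *: 1)).
move=> h1 h2; have /eqP : g ('i%C *: 1) ^+ 2 = 0 by lra.
by rewrite sqrf_eq0 oppr_eq0.
Qed.

End states.

(** * The numerical radius and the Cartesian decomposition *)

Section numerical_radius.
Set Implicit Arguments.
Unset Strict Implicit.
Context {R : realType} {A : cstarAlgType R}.
Implicit Types (a h : A) (f : {linear A -> R[i]^o}).

Lemma state_le_numradius f a : states f -> rnorm (f a) <= numradius a.
Proof.
move=> fs; apply: ub_le_sup; last by exists f.
by exists (rnorm a) => _ [g gs <-]; exact: state_le_rnorm.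
Qed.

Lemma numradius_ge0 a : 0 <= numradius a.
Proof.
have [|f fs _] := @exists_state R A 0 0.
  by move=> t _; rewrite scaler0 mulr0 !addr0 rnorm1.
by apply: le_trans (state_le_numradius a fs); exact: rnorm_ge0.
Qed.

Lemma exists_state_selfadj h : star h = h ->
  exists2 f, states f & rnorm h <= `|complex.Re (f h)|.
Proof.
move=> /rnorm_selfadj_sign[hp|hm].
  have [f fs fh] := exists_state hp; exists f => //.
  exact: le_trans fh (ler_norm _).
have [|f fs fh] := @exists_state R A (- h) (rnorm h).
  by move=> t t0; rewrite scalerN; exact: hm.
exists f => //; apply: le_trans fh _; rewrite linearN.
by case: (f h) => u v /=; rewrite ler_normr lexx orbT.
Qed.

Lemma star_cre a : star (cre a) = cre a.
Proof. by rewrite /cre starZ starD starK addrC conjc_inv conjc_nat. Qed.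

Lemma star_cim a : star (cim a) = cim a.
Proof.
rewrite /cim starZ starD starN starK conjc_inv -(opprB a) scalerN -scaleNr.
congr (_ *: _); rewrite -invrN; congr (_^-1).
by apply/eqP; rewrite eq_complex/=; apply/andP; split; apply/eqP; ring.
Qed.

Lemma cre_cimE a : a = cre a + 'i%C *: cim a.
Proof.
have i0 : 'i%C != 0 :> R[i] by rewrite eq_complex/= oner_eq0 andbF.
rewrite /cre /cim scalerA invfM mulrCA mulfV// mulr1 -scalerDr addrACA subrr addr0.
by rewrite -mulr2n -[a *+ 2]scaler_nat scalerA mulVf ?scale1r// pnatr_eq0.
Qed.

Lemma star_cre_cimE a : star a = cre a - 'i%C *: cim a.
Proof.
rewrite {1}(cre_cimE a) starD star_cre starZ star_cim -scaleNr; congr (_ + _ *: _).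
by apply/eqP; rewrite eq_complex/= oppr0 !eqxx.
Qed.

(** As [f] is real on self-adjoint elements, [f (cre a)] and [f (cim a)] are the real and imaginary
    parts of [f a]. *)
Lemma state_rnorm_sqr f a : states f ->
  rnorm (f a) ^+ 2 = complex.Re (f (cre a)) ^+ 2 + complex.Re (f (cim a)) ^+ 2.
Proof.
move=> fs; rewrite {1}(cre_cimE a) linearD [f ('i%C *: _)]linearZ/= rnorm_complex_sqr.
have := state_selfadj_real fs (star_cre a); have := state_selfadj_real fs (star_cim a).
by case: (f (cre a)) => u v; case: (f (cim a)) => w x /= -> ->; ring.
Qed.

Lemma rnorm_combination_le_numradius a (c s : R) :
  rnorm (c%:C%C *: cre a + s%:C%C *: cim a) ^+ 2 <= (c ^+ 2 + s ^+ 2) * numradius a ^+ 2.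
Proof.
set h := _ + _; have hh : star h = h by rewrite starD !star_real star_cre star_cim.
have [f fs fh] := exists_state_selfadj hh.
have := state_le_numradius a fs.
rewrite -(@ler_sqr _ (rnorm _)) ?nnegrE ?rnorm_ge0 ?numradius_ge0// => fa.
apply: le_trans (ler_wpM2l _ fa); last by rewrite addr_ge0 ?sqr_ge0.
move: fh; rewrite -(@ler_sqr _ (rnorm _)) ?nnegrE ?rnorm_ge0// real_normK ?num_real//.
move=> /le_trans; apply; rewrite state_rnorm_sqr//.
have -> : complex.Re (f h) = c * complex.Re (f (cre a)) + s * complex.Re (f (cim a)).
  rewrite linearD [f (c%:C%C *: _)]linearZ [f (s%:C%C *: _)]linearZ/=.
  case: (f (cre a)) => u v; case: (f (cim a)) => w x /=.
  by ring.
set u := complex.Re _; set v := complex.Re _.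
(* Lagrange's identity: the defect in Cauchy-Schwarz is a square. *)
rewrite -subr_ge0; have -> : (c ^+ 2 + s ^+ 2) * (u ^+ 2 + v ^+ 2) - (c * u + s * v) ^+ 2
  = (c * v - s * u) ^+ 2 by ring.
exact: sqr_ge0.
Qed.

(** Used twice: [z = - y] with [y = i cim a] gives [a a^* + a^* a], and [z = y] gives the sum of the
    squares of [x + y] and [x - y]. *)
Lemma mulrD_add_mulrB (S : pzRingType) (x y z : S) :
  (x + y) * (x + z) + (x - y) * (x - z) = (x * x + y * z) *+ 2.
Proof.
have -> : (x + y) * (x + z) = x * x + y * z + (x * z + y * x).
  by rewrite mulrDl !mulrDr [y * x + _]addrC addrACA.
have -> : (x - y) * (x - z) = x * x + y * z - (x * z + y * x).
  by rewrite mulrDl !mulrDr !mulrN !mulNr opprK [- _ + y * z]addrC addrACA opprD.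
by rewrite addrACA subrr addr0 mulr2n.
Qed.

Lemma star_mul_sumE a :
  star a * a + a * star a = 2%:R%:C%C *: (cre a ^+ 2 + cim a ^+ 2).
Proof.
have := mulrD_add_mulrB (cre a) ('i%C *: cim a) (- ('i%C *: cim a)).
rewrite opprK -cre_cimE -star_cre_cimE addrC rmorph_nat scaler_nat => ->.
move: (cre a) (cim a) => x y.
by rewrite mulrN -scalerAl -scalerAr scalerA -(expr2 'i%C) sqr_i scaleN1r opprK.
Qed.

Lemma rnorm_star_mul_sum_le a : rnorm (star a * a + a * star a) <=
  2 * (rnorm (cre a) ^+ 2 + rnorm (cim a) ^+ 2).
Proof.
rewrite star_mul_sumE rnormZr ger0_norm// ler_wpM2l//.
by apply: le_trans (ler_rnormD _ _) _; rewrite lerD ?rnormX.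
Qed.

Lemma rnorm_star_mul_sum_le_rot a : rnorm (star a * a + a * star a) <=
  rnorm (cre a + cim a) ^+ 2 + rnorm (cre a - cim a) ^+ 2.
Proof.
have -> : star a * a + a * star a = (cre a + cim a) ^+ 2 + (cre a - cim a) ^+ 2.
  rewrite star_mul_sumE rmorph_nat scaler_nat.
  exact/esym/(mulrD_add_mulrB (cre a) (cim a) (cim a)).
by apply: le_trans (ler_rnormD _ _) _; rewrite lerD ?rnormX.
Qed.

End numerical_radius.

Theorem theorem2p6 (R : realType) (A : cstarAlgType R) (a : A) :
  let N := rnorm (star a * a + a * star a) in
  let alpha := `| rnorm (cre a) ^+ 2 - 1 / 4 * N | in
  let beta := `| rnorm (cim a) ^+ 2 - 1 / 4 * N | in
  [/\ numradius a ^+ 2 >=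
        1 / 4 * N + 1 / 2 * `| rnorm (cre a) ^+ 2 - rnorm (cim a) ^+ 2 |,
      numradius a ^+ 2 >=
        1 / 4 * N
        + 1 / 4 * `| rnorm (cre a + cim a) ^+ 2 - rnorm (cre a - cim a) ^+ 2 |
    & numradius a ^+ 2 >= 1 / 4 * N + 1 / 4 * (alpha + beta)].
Proof.
move=> N alpha beta.
have hr := rnorm_combination_le_numradius a 1 0.
have hi := rnorm_combination_le_numradius a 0 1.
have hp := rnorm_combination_le_numradius a 1 1.
have hm := rnorm_combination_le_numradius a 1 (-1).
rewrite ?rmorphN ?rmorph0 ?rmorph1 ?scaleN1r ?scale0r ?scale1r ?addr0 ?add0r in hr hi hp hm.
have N1 : N <= _ := rnorm_star_mul_sum_le a.
have N2 : N <= _ := rnorm_star_mul_sum_le_rot a.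
(* The first two bounds combine [N1] or [N2] with [max p q = (p + q) / 2 + |p - q| / 2]. In the
   third, if both differences are nonpositive, [N1] forces them to vanish. *)
split.
- by case: ler0P; lra.
- by case: ler0P; lra.
- by rewrite /alpha /beta; case: ler0P => ?; case: ler0P => ?; lra.
Qed.
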